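(* Any $\ell$-controllable complete group system $A$ can be recovered from its $(\ell+1)$-depth elementary system $\mathcal{E}_A$ as follows. Let $(\mathcal{U},\star)$ be the global group of $\mathcal{E}_A$, and let $f_u=(\ldots,f_u^t,f_u^{t+1},\ldots)$, where for $\mathbf{u}\in\mathcal{U}$, $f_u^t(\mathbf{u})=\prod_{j=0}^{\ell}\bigl(\prod_{k=j}^{\ell}\chi^t(\mathbf{g}^{[t-j,t-j+k]})\bigr)$ and $\mathbf{g}^{[t-j,t-j+k]}$ is the generator of $A$ whose label is the entry $g_k^{t-j}$ of $\mathbf{u}$. Then $f_u$ is a homomorphism from $(\mathcal{U},\star)$ to the direct product group $\prod_{t\in\mathbf{Z}}A^t$ with $\operatorname{im}f_u=A$.
   Context: Let $(A^t)_{t\in\mathbf{Z}}$ be finite groups. A group system $A$ is a set of sequences $\mathbf{a}=(a^t)_{t\in\mathbf{Z}}$, $a^t\in A^t$, forming a group under componentwise operation, such that every element of $A^t$ occurs as a time-$t$ component, for each $t$. $\chi^t:A\to A^t$ is $\mathbf{a}\mapsto a^t$. $A$ is $\ell$-controllable ($\ell>0$) if for every $t\in\mathbf{Z}$ and all $\dot{\mathbf{a}},\ddot{\mathbf{a}}\in A$ there is $\mathbf{a}\in A$ agreeing with $\dot{\mathbf{a}}$ at all times $<t$ and with $\ddot{\mathbf{a}}$ at all times $\ge t+\ell$. $A$ is complete if every sequence in $\prod_t A^t$ whose restriction to each finite interval is the restriction of some element of $A$ belongs to $A$. $A^{[m,n]}$ is the set of sequences in $A$ that are the identity outside $[m,n]$.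 $X^t$ (resp. $Y^t$) is the normal subgroup of sequences in $A$ that are the identity at all times $<t$ (resp. $>t$). Basis: for $t\in\mathbf{Z}$, $0\le k\le\ell$ put $\Lambda^{[t,t+k]}=X^{t+1}(X^t\cap Y^{t+k})/X^{t+1}(X^t\cap Y^{t+k-1})$. A basis is a choice, for each $(k,t)$, of a transversal $[\Lambda^{[t,t+k]}]$ whose elements (generators $\mathbf{g}^{[t,t+k]}$) lie in $A^{[t,t+k]}$ and in which the trivial coset is represented by the identity sequence. $\mathcal{R}=\prod_{t\in\mathbf{Z}}\prod_{0\le k\le\ell}[\Lambda^{[t,t+k]}]$. The map $\alpha:\mathcal{R}\to A$ sends $\mathbf{r}=(\mathbf{g}^{[t,t+k]})_{k,t}$ to $\prod_{i=+\infty}^{-\infty}\prod_{m=0}^{\ell}\mathbf{g}^{[i,i+m]}$, i.e. the sequence with time-$t$ component $\prod_{j=0}^{\ell}\bigl(\prod_{k=j}^{\ell}\chi^t(\mathbf{g}^{[t-j,t-j+k]})\bigr)$ (factors written left to right in increasing $j$, and increasing $k$ for each $j$); $\alpha$ is a bijection. The operation $*$ on $\mathcal{R}$ is $\dot{\mathbf{r}}*\ddot{\mathbf{r}}=\alpha^{-1}(\alpha(\dot{\mathbf{r}})\alpha(\ddot{\mathbf{r}}))$. For each $(k,t)$ let $G_k^t$ be a set of labels with a fixed bijection $[\Lambda^{[t,t+k]}]\to G_k^t$, $\mathbf{g}^{[t,t+k]}\mapsto g_k^t$. $\mathcal{U}=\prod_{t\in\mathbf{Z}}\prod_{0\le k\le\ell}G_k^t$,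 and $\beta:\mathcal{R}\to\mathcal{U}$ replaces each generator by its label. The operation $\circ$ on $\mathcal{U}$ is $\beta(\dot{\mathbf{r}})\circ\beta(\ddot{\mathbf{r}})=\beta(\dot{\mathbf{r}}*\ddot{\mathbf{r}})$; $(\mathcal{U},\circ)$ is the generator group. Upper triangles: for $t\in\mathbf{Z}$, $0\le k\le\ell$ let $T_k^t=\{(m,t-j):0\le j\le\ell-k,\ k+j\le m\le\ell\}$. For $\mathbf{u}=(g_m^s)\in\mathcal{U}$, $\nabla_{0,k}^t(\mathbf{u})=(g_m^s)_{(m,s)\in T_k^t}$, and $\nabla_{0,k}^t(\mathcal{U})=\{\nabla_{0,k}^t(\mathbf{u}):\mathbf{u}\in\mathcal{U}\}$. The upper elementary group $(\nabla_{0,k}^t(\mathcal{U}),\circledcirc_{0,k}^t)$ has the (well-defined) operation $\nabla_{0,k}^t(\dot{\mathbf{u}})\circledcirc_{0,k}^t\nabla_{0,k}^t(\ddot{\mathbf{u}})=\nabla_{0,k}^t(\dot{\mathbf{u}}\circ\ddot{\mathbf{u}})$. The elementary system $\mathcal{E}_A$ of $A$ is the set $\mathcal{U}$ together with the list of groups $\{(\nabla_{0,k}^t(\mathcal{U}),\circledcirc_{0,k}^t):0\le k\le\ell,t\in\mathbf{Z}\}$. Its global group $(\mathcal{U},\star)$ is $\mathcal{U}$ with $\dot{\mathbf{u}}\star\ddot{\mathbf{u}}$ the unique $\bar{\mathbf{u}}\in\mathcal{U}$ such that $\nabla_{0,0}^t(\bar{\mathbf{u}})=\nabla_{0,0}^t(\dot{\mathbf{u}})\circledcirc_{0,0}^t\nabla_{0,0}^t(\ddot{\mathbf{u}})$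 for all $t\in\mathbf{Z}$. *)

(* Defs.v *)
From HB Require Import structures.
From mathcomp Require Import all_boot all_order all_fingroup all_algebra.
From mathcomp Require Import boolp classical_sets.

Set Implicit Arguments.
Unset Strict Implicit.
Unset Printing Implicit Defensive.

Import Order.TTheory GRing.Theory Num.Theory.

Local Open Scope classical_set_scope.
Local Open Scope ring_scope.

(* The direct product over all times [t : int] of the finite groups [gT t]. *)
Definition sequence (gT : int -> finGroupType) := forall t : int, gT t.

Section SequenceGroup.
Variable gT : int -> finGroupType.
Implicit Types a b c : sequence gT.

HB.instance Definition _ := gen_eqMixin (sequence gT).
HB.instance Definition _ := gen_choiceMixin (sequence gT).

Definition seq_one : sequence gT := fun=> 1%g.
Definition seq_inv a : sequence gT := fun t => ((a t)^-1)%g.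
Definition seq_mul a b : sequence gT := fun t => (a t * b t)%g.

Lemma seq_mulA : associative seq_mul.
Proof. by move=> a b c; apply: functional_extensionality_dep => t; apply: mulgA. Qed.
Lemma seq_mul1 : left_id seq_one seq_mul.
Proof. by move=> a; apply: functional_extensionality_dep => t; apply: mul1g. Qed.
Lemma seq_mulr1 : right_id seq_one seq_mul.
Proof. by move=> a; apply: functional_extensionality_dep => t; apply: mulg1. Qed.
Lemma seq_mulV : left_inverse seq_one seq_inv seq_mul.
Proof. by move=> a; apply: functional_extensionality_dep => t; apply: mulVg. Qed.
Lemma seq_mulrV : right_inverse seq_one seq_inv seq_mul.
Proof. by move=> a; apply: functional_extensionality_dep => t; apply: mulgV. Qed.

HB.instance Definition _ := isGroup.Build (sequence gT)
  seq_mulA seq_mul1 seq_mulr1 seq_mulV seq_mulrV.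
End SequenceGroup.

Section GroupSystem.
Variables (gT : int -> finGroupType) (A : set (sequence gT)).

Definition group_system :=
  [/\ A 1%g,
      forall a b, A a -> A b -> A (a * b)%g,
      forall a, A a -> A (a^-1)%g &
      forall (t : int) (x : gT t), exists2 a, A a & a t = x].

Definition controllable (l : nat) :=
  forall (t : int) (a b : sequence gT), A a -> A b ->
    exists c, [/\ A c,
                  forall s : int, s < t -> c s = a s &
                  forall s : int, t + l%:Z <= s -> c s = b s].

Definition complete :=
  forall a : sequence gT,
    (forall m n : int, exists2 b, A b & forall s, m <= s <= n -> b s = a s) ->
    A a.

(* [Xsub t] is X^t, [Ysub t] is Y^t and [span m n] is A^{[m,n]}. *)
Definition Xsub (t : int) : set (sequence gT) :=
  [set a | A a /\ forall s : int, s < t -> a s = 1%g].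
Definition Ysub (t : int) : set (sequence gT) :=
  [set a | A a /\ forall s : int, t < s -> a s = 1%g].
Definition span (m n : int) : set (sequence gT) :=
  [set a | A a /\ forall s : int, ~~ (m <= s <= n) -> a s = 1%g].

(* X^{t+1} (X^t \cap Y^n) *)
Definition XXY (t n : int) : set (sequence gT) :=
  [set (x * y)%g | x in Xsub (t + 1) & y in Xsub t `&` Ysub n].

(* The quotient \Lambda^{[t,t+k]}, as the set of its cosets. *)
Definition Lambda (k : nat) (t : int) : set (set (sequence gT)) :=
  [set [set (x * d)%g | d in XXY t (t + k%:Z - 1)] | x in XXY t (t + k%:Z)].

End GroupSystem.

Definition transversal (T : Type) (P : set (set T)) (S : set T) :=
  S `<=` \bigcup_(C in P) C /\ forall C, P C -> exists! g, (C `&` S) g.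

Record basis (gT : int -> finGroupType) (A : set (sequence gT)) (l : nat) :=
  Basis {
    gens : 'I_l.+1 -> int -> set (sequence gT);
    gens_transversal : forall (k : 'I_l.+1) t, transversal (Lambda A k t) (gens k t);
    gens_span : forall (k : 'I_l.+1) t, gens k t `<=` span A t (t + k%:Z);
    gens_one : forall k t, gens k t 1%g }.

Record labelling (gT : int -> finGroupType) (A : set (sequence gT)) (l : nat)
    (B : basis A l) := Labelling {
  lab : 'I_l.+1 -> int -> Type;
  label : forall k t, gens B k t -> lab k t;
  unlabel : forall k t, lab k t -> gens B k t;
  labelK : forall k t, cancel (@label k t) (@unlabel k t);
  unlabelK : forall k t, cancel (@unlabel k t) (@label k t) }.

Section Elementary.
Variables (l : nat) (G : 'I_l.+1 -> int -> Type).

(* \mathcal{U} *)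
Definition label_tensor := forall (k : 'I_l.+1) (t : int), G k t.

HB.instance Definition _ := gen_eqMixin label_tensor.
HB.instance Definition _ := gen_choiceMixin label_tensor.

(* T_k^t *)
Definition tri_index (k : 'I_l.+1) (t : int) : set ('I_l.+1 * int) :=
  [set p : 'I_l.+1 * int | exists j : nat,
      [/\ (j <= l - k)%N, (k + j <= p.1)%N & p.2 = t - j%:Z]].

Definition triangle (k : 'I_l.+1) (t : int) :=
  forall p : tri_index k t, G (val p).1 (val p).2.

HB.instance Definition _ k t := gen_eqMixin (triangle k t).
HB.instance Definition _ k t := gen_choiceMixin (triangle k t).

(* \nabla_{0,k}^t *)
Definition nabla (k : 'I_l.+1) (t : int) (u : label_tensor) : triangle k t :=
  fun p => u (val p).1 (val p).2.
Arguments nabla : clear implicits.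

(* The set \mathcal{U} is given by [G]; the (k, t) group of the list has
   carrier [range (nabla k t)] and operation [up_op k t], whose values outside
   the carrier are irrelevant. *)
Record elementary_system := ElementarySystem {
  up_op : forall k t, triangle k t -> triangle k t -> triangle k t }.

(* The unique tensor all of whose triangles nabla_{0,0}^t are the products of
   those of [u] and [v]; the default value [u] is irrelevant. *)
Definition global_op (E : elementary_system) (u v : label_tensor)
    : label_tensor :=
  xget u [set w | forall t,
    nabla ord0 t w = up_op E (nabla ord0 t u) (nabla ord0 t v)].

End Elementary.

Arguments nabla {l G} k t u p.

Section GeneratorGroup.
Variables (gT : int -> finGroupType) (A : set (sequence gT)) (l : nat).
Variables (B : basis A l) (L : labelling B).

(* \mathcal{R} *)
Definition gen_tensor := forall (k : 'I_l.+1) (t : int), gens B k t.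

HB.instance Definition _ := gen_eqMixin gen_tensor.
HB.instance Definition _ := gen_choiceMixin gen_tensor.

Definition alpha (r : gen_tensor) : sequence gT := fun t =>
  (\prod_(j < l.+1) \prod_(k < l.+1 | (j <= k)%N)
     (val (r k (t - j%:Z)%R) : sequence gT) t)%g.

(* The operation * on \mathcal{R}: alpha^{-1} (alpha r1 * alpha r2). As alpha is
   a bijection onto [A], the default value [r1] is irrelevant. *)
Definition gen_op (r1 r2 : gen_tensor) : gen_tensor :=
  xget r1 [set r | alpha r = (alpha r1 * alpha r2)%g].

Definition beta (r : gen_tensor) : label_tensor (lab L) :=
  fun k t => label L (r k t).
Definition beta_inv (u : label_tensor (lab L)) : gen_tensor :=
  fun k t => unlabel (u k t).

Definition lab_op (u v : label_tensor (lab L)) : label_tensor (lab L) :=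
  beta (gen_op (beta_inv u) (beta_inv v)).

(* The element [nabla (lab_op u v)] for any [u], [v] with triangles [x], [y];
   it does not depend on [u], [v]. *)
Definition triangle_op k t (x y : triangle (lab L) k t) : triangle (lab L) k t :=
  xget x [set z | exists u v : label_tensor (lab L),
    [/\ nabla k t u = x, nabla k t v = y & z = nabla k t (lab_op u v)]].

Definition elementary_system_of : elementary_system (lab L) :=
  ElementarySystem triangle_op.

Definition f_u (u : label_tensor (lab L)) : sequence gT := fun t =>
  (\prod_(j < l.+1) \prod_(k < l.+1 | (j <= k)%N)
     (val (unlabel (u k (t - j%:Z)%R)) : sequence gT) t)%g.

End GeneratorGroup.

Definition group_law (T : Type) (op : T -> T -> T) :=
  exists (e : T) (inv : T -> T),
    [/\ associative op, left_id e op, right_id e op,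
        left_inverse e inv op & right_inverse e inv op].

(* Main.v *)
(* Let N_t = X^{t+1} Y^{t-1}, a normal subgroup of A whose elements are the
   identity at time t. Modulo N_t, every generator starting after t or ending
   before t disappears from the product defining alpha(r), so alpha(r) is
   congruent to the product of the generators in the triangle T_0^t. Peeling
   this product off from the right, Dedekind's law and the transversal property
   show that the congruence class of alpha(r) in turn determines these
   generators: nabla_{0,0}^t is a bijective encoding of A / N_t, which makes the
   triangle product well defined.

   By controllability A = X^s Y^{s+l-1}, and an element of X^s can be stripped
   of its generators column by column. So every element of A is, on any window of
   times t, congruent modulo N_t to some alpha(r); uniqueness of the triangles
   glues these r, whence alpha is onto A. The global operation is then the
   operation carried over from A by the bijection f_u. *)
Require Import Defs.
From mathcomp Require Import all_boot all_order all_fingroup all_algebra zify.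
From mathcomp Require Import boolp classical_sets.

Set Implicit Arguments.
Unset Strict Implicit.
Unset Printing Implicit Defensive.

Import Order.TTheory GRing.Theory.

Local Open Scope classical_set_scope.

(** * Normal subgroups and congruences inside a group given as a set *)

Section NormalIn.
Local Open Scope group_scope.
Variable G : groupType.
Implicit Types (A M N : set G) (a b c d : G).

(** [normal_in A A] says just that [A] is a subgroup, so one record serves for groups and normal
    subgroups. Congruence modulo [N] is written [N (a * b^-1)] throughout. *)
Record normal_in A N : Prop := NormalIn {
  normal_inS : N `<=` A;
  normal_in1 : N 1;
  normal_inM : forall a b, N a -> N b -> N (a * b);
  normal_inV : forall a, N a -> N a^-1;
  normal_inJ : forall a b, A a -> N b -> N (a * b * a^-1) }.

Lemma normal_inI A M N : normal_in A M -> normal_in A N ->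
  normal_in A (M `&` N).
Proof.
move=> nM nN; split.
- by move=> a [/(normal_inS nM)].
- by split; apply: normal_in1; eassumption.
- move=> a b [Ma Na] [Mb Nb].
  by split; [apply: (normal_inM nM)|apply: (normal_inM nN)].
- by move=> a [Ma Na]; split; [apply: (normal_inV nM)|apply: (normal_inV nN)].
- move=> a b Aa [Mb Nb].
  by split; [apply: (normal_inJ nM)|apply: (normal_inJ nN)].
Qed.

Lemma normal_in_mul A M N : normal_in A A ->
    normal_in A M -> normal_in A N ->
  normal_in A [set a * b | a in M & b in N].
Proof.
move=> nA nM nN; split.
- move=> _ [a Ma [b Nb <-]].
  by apply: (normal_inM nA); [apply: (normal_inS nM)|apply: (normal_inS nN)].
- exists 1; first exact: normal_in1 nM.
  by exists 1; [exact: normal_in1 nN|rewrite mulg1].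
- move=> _ _ [a Ma [b Nb <-]] [c Mc [d Nd <-]].
  exists (a * (b * c * b^-1)).
    apply: (normal_inM nM) => //; apply: (normal_inJ nM) => //.
    exact: (normal_inS nN).
  by exists (b * d); [exact: (normal_inM nN)|rewrite !mulgA mulgVK].
- move=> _ [a Ma [b Nb <-]].
  exists (b^-1 * a^-1 * b^-1^-1).
    apply: (normal_inJ nM); last exact: (normal_inV nM).
    exact/(normal_inS nN)/(normal_inV nN).
  by exists b^-1; [exact: (normal_inV nN)|rewrite mulgVK invgM].
- move=> a _ Aa [b Mb [c Nc <-]].
  exists (a * b * a^-1); first exact: (normal_inJ nM).
  by exists (a * c * a^-1); [exact: (normal_inJ nN)|rewrite !mulgA mulgVK].
Qed.

Section Congruence.
Variables A N : set G.
Hypothesis nN : normal_in A N.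

Lemma cong_refl a : N (a * a^-1).
Proof. by rewrite mulgV; exact: normal_in1 nN. Qed.

Lemma cong_sym a b : N (a * b^-1) -> N (b * a^-1).
Proof. by move=> /(normal_inV nN); rewrite invgM invgK. Qed.

Lemma cong_trans b a c : N (a * b^-1) -> N (b * c^-1) -> N (a * c^-1).
Proof. by move=> Nab /(normal_inM nN Nab); rewrite mulgA mulgVK. Qed.

Lemma cong_mul a b c d : A a -> N (a * b^-1) -> N (c * d^-1) ->
  N ((a * c) * (b * d)^-1).
Proof.
move=> Aa Nab /(normal_inJ nN Aa) /(normal_inM nN) /(_ Nab).
by rewrite invgM !mulgA mulgVK.
Qed.

Lemma cong_prod (n : nat) (P : pred 'I_n) (h h' : 'I_n -> G) :
    (forall i, A (h i)) -> (forall i, P i -> N (h i * (h' i)^-1)) ->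
  N ((\prod_(i < n | P i) h i) * (\prod_(i < n | P i) h' i)^-1).
Proof.
move=> Ah Nh; apply: (big_rec2 (fun a b => N (a * b^-1))) => [|i a b Pi Nab].
  exact: cong_refl.
by apply: cong_mul => //; exact: Nh.
Qed.

Lemma prod_in (n : nat) (P : pred 'I_n) (h : 'I_n -> G) :
  (forall i, P i -> N (h i)) -> N (\prod_(i < n | P i) h i).
Proof.
by move=> Nh; apply: big_ind => //; [exact: normal_in1 nN|exact: normal_inM nN].
Qed.

End Congruence.

(** Peeling from the right: all factors but the last lie in [M ord_max], so the last factors are
    congruent modulo it, hence equal. They cancel exactly, and the shorter products are again
    congruent modulo [N]. *)
Lemma prod_cong_inj A N (n : nat) (M : 'I_n -> set G) (h h' : 'I_n -> G) :
    normal_in A A -> (forall i, normal_in A (M i)) ->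
    (forall i, N `<=` M i) ->
    (forall i j : 'I_n, (j < i)%N -> M i (h j) /\ M i (h' j)) ->
    (forall i, M i (h i * (h' i)^-1) -> h i = h' i) ->
    N ((\prod_(i < n) h i) * (\prod_(i < n) h' i)^-1) ->
  forall i, h i = h' i.
Proof.
move=> nA; elim: n M h h' => [|n IHn] M h h' nM NM Mh inj Nh; first by case.
pose w := @widen_ord n n.+1 (leqnSn n).
have := Nh; rewrite !big_ord_recr /= -/w.
set p := (\prod_(i < n) h _); set p' := (\prod_(i < n) h' _) => Npp'.
have Mp : M ord_max p.
  by apply: (prod_in (nM _)) => i _; apply: (Mh _ _ _).1 => /=.
have Mp' : M ord_max p'.
  by apply: (prod_in (nM _)) => i _; apply: (Mh _ _ _).2 => /=.
have e : h ord_max = h' ord_max.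
  apply: inj.
  have := normal_inM (nM _) (normal_inV (nM _) Mp) (NM ord_max _ Npp').
  move=> /(normal_inM (nM _))/(_ Mp').
  by rewrite invgM !mulgA mulVg mul1g mulgVK.
move=> i; case: (unliftP ord_max i) => [j ->|->] //.
have -> : lift ord_max j = w j by apply: val_inj; rewrite /= /bump leqNgt ltn_ord.
apply: (IHn (fun i => M (w i)) (fun i => h (w i)) (fun i => h' (w i))) => //.
- by move=> i1 j1 lt; apply: Mh.
- by move=> i1; exact: inj.
- by move: Npp'; rewrite e invgM mulgA mulgK.
Qed.

Lemma prod_cut (n m : nat) (h : 'I_n -> G) :
  \prod_(i < n) h i =
  (\prod_(i < n) (if (i < m)%N then h i else 1)) *
  (\prod_(i < n) (if (i < m)%N then 1 else h i)).
Proof.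
elim: n h => [|n IHn] h; first by rewrite !big_ord0 mulg1.
rewrite !big_ord_recr /= [in LHS]IHn.
case: ifP => [lt|]; last by rewrite mulg1 mulgA.
rewrite [X in _ = _ * (X * _)]big1 ?[X in _ * X * _ = _]big1 ?mulg1 //= => i _.
all: by rewrite (ltn_trans (ltn_ord i) lt).
Qed.

Lemma transversal_inj A N P S g g' : normal_in A A -> normal_in A N ->
    P `<=` A -> Defs.transversal [set [set x * d | d in N] | x in P] S ->
    S g -> S g' -> N (g * g'^-1) ->
  g = g'.
Proof.
move=> nA nN PA [sub ex1] Sg Sg' Ngg'.
have [C PC Cg] := sub _ Sg.
have [g0 [_ g0P]] := ex1 _ PC.
rewrite -(g0P g)// -(g0P g')//; split=> //.
move: PC Cg => [x Px <-] [d Nd xd]; exists (x^-1 * g'); last by rewrite mulVKg.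
(* The cosets are left cosets, whereas congruence puts the quotient on the right; conjugating by [x]
   passes from one to the other. *)
have -> : x^-1 * g' = x^-1 * (g * g'^-1)^-1 * x^-1^-1 * d.
  by rewrite -xd !invgM !invgK !mulgA mulgVK mulgVK.
apply: (normal_inM nN) => //.
apply: (normal_inJ nN); last exact: (normal_inV nN).
exact/(normal_inV nA)/PA.
Qed.

Lemma transversal_ex A N P S a : normal_in A N -> P `<=` A ->
    Defs.transversal [set [set x * d | d in N] | x in P] S -> P a ->
  exists2 g, S g & N (a * g^-1).
Proof.
move=> nN PA [_ ex1] Pa.
have [|g [[[d Nd <-] Sg] _]] := ex1 [set a * d | d in N]; first by exists a.
exists (a * d) => //; rewrite invgM mulgA.
by apply: (normal_inJ nN); [exact: PA|exact: (normal_inV nN)].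
Qed.

End NormalIn.

Lemma seq_prodE (gT : int -> finGroupType) (I : Type) (s : seq I) (P : pred I)
    (h : I -> sequence gT) (t : int) :
  (\prod_(i <- s | P i) h i)%g t = (\prod_(i <- s | P i) h i t)%g.
Proof. exact: (big_morph (fun a : sequence gT => a t)). Qed.

(** * Sequences of A vanishing before or after a given time *)

Section System.
Local Open Scope ring_scope.
Variables (gT : int -> finGroupType) (A : set (sequence gT)) (l : nat).
Hypotheses (A_sys : group_system A) (A_ctrl : controllable A l).
Hypothesis A_complete : complete A.
Implicit Types (a b x y : sequence gT) (s t n e : int).

Lemma seqP a b : (forall t, a t = b t) -> a = b.
Proof. by move=> ab; apply: functional_extensionality_dep. Qed.

Lemma seq_mulE a b t : (a * b)%g t = (a t * b t)%g. Proof. by []. Qed.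
Lemma seq_invE a t : (a^-1)%g t = ((a t)^-1)%g. Proof. by []. Qed.
Lemma seq_oneE t : (1 : sequence gT)%g t = 1%g. Proof. by []. Qed.
Definition seqE := (seq_mulE, seq_invE, seq_oneE).

Lemma system_normal : normal_in A A.
Proof.
have [A1 AM AV _] := A_sys; split=> // a b Aa Ab.
by apply: (AM _ _ (AM _ _ Aa Ab)); exact: AV.
Qed.

Lemma normal_vanishing (P : int -> Prop) :
  normal_in A [set a | A a /\ forall s, P s -> a s = 1%g].
Proof.
have nA := system_normal; split.
- by move=> a [].
- by split=> //; exact: normal_in1 nA.
- move=> a b [Aa a1] [Ab b1]; split; first exact: (normal_inM nA).
  by move=> s Ps; rewrite seqE a1// b1// mulg1.
- move=> a [Aa a1]; split; first exact: (normal_inV nA).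
  by move=> s Ps; rewrite seqE a1// invg1.
- move=> a b Aa [Ab b1]; split; first exact: (normal_inJ nA).
  by move=> s Ps; rewrite !seqE b1// mulg1 mulgV.
Qed.

Lemma Xsub_normal s : normal_in A (Xsub A s).
Proof. exact: (normal_vanishing (fun i => i < s)). Qed.

Lemma Ysub_normal e : normal_in A (Ysub A e).
Proof. exact: (normal_vanishing (fun i => e < i)). Qed.

Lemma Xsub_le s t : s <= t -> Xsub A t `<=` Xsub A s.
Proof. by move=> st a [Aa a1]; split=> // i ?; apply: a1; lia. Qed.

Lemma Ysub_le s t : s <= t -> Ysub A s `<=` Ysub A t.
Proof. by move=> st a [Aa a1]; split=> // i ?; apply: a1; lia. Qed.

(** The subgroup N_t is [XY (t + 1) (t - 1)]. *)
Definition XY s e : set (sequence gT) :=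
  [set (x * y)%g | x in Xsub A s & y in Ysub A e].

Lemma XY_normal s e : normal_in A (XY s e).
Proof.
exact: normal_in_mul system_normal (Xsub_normal s) (Ysub_normal e).
Qed.

Lemma Xsub_XY s e : Xsub A s `<=` XY s e.
Proof.
move=> x Xx; exists x => //; exists 1%g; last by rewrite mulg1.
exact: normal_in1 (Ysub_normal e).
Qed.

Lemma Ysub_XY s e : Ysub A e `<=` XY s e.
Proof.
move=> y Yy; exists 1%g; first exact: normal_in1 (Xsub_normal s).
by exists y; rewrite // mul1g.
Qed.

Lemma XY_le s s' e e' : s' <= s -> e <= e' -> XY s e `<=` XY s' e'.
Proof.
move=> ss ee _ [x Xx [y Yy <-]].
by exists x; [exact: Xsub_le Xx|exists y; [exact: Ysub_le Yy|]].
Qed.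

Lemma XY_at t a b : XY (t + 1) (t - 1) (a * b^-1)%g -> a t = b t.
Proof.
case=> x [_ x1] [y [_ y1] xy].
have := congr1 (fun c : sequence gT => c t) xy.
rewrite !seqE x1; last lia.
rewrite y1; last lia.
by rewrite mulg1 => /esym/eqP; rewrite -eq_mulgV1 => /eqP.
Qed.

(** Controllability joins the past of [a] before [s] to the identity from [s + l] on; the joining
    sequence is the Y-factor and the rest of [a] vanishes before [s]. *)
Lemma controllable_split s a : A a -> XY s (s + l%:Z - 1) a.
Proof.
move=> Aa; have nA := system_normal.
have [y [Ay ya y1]] := A_ctrl s Aa (normal_in1 nA).
exists (a * y^-1)%g.
  split; first by apply: (normal_inM nA) => //; exact: (normal_inV nA).
  by move=> i si; rewrite !seqE ya// mulgV.
exists y; last by rewrite mulgVK.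
by split=> // i si; rewrite y1 ?seqE//; lia.
Qed.

Lemma XXY_normal t n : normal_in A (XXY A t n).
Proof.
apply: normal_in_mul; [exact: system_normal|exact: Xsub_normal|].
by apply: normal_inI; [exact: Xsub_normal|exact: Ysub_normal].
Qed.

(* Dedekind's modular law *)
Lemma Xsub_XY_XXY t n a : Xsub A t a -> XY (t + 1) n a -> XXY A t n a.
Proof.
move=> Xa [x Xx [y Yy xy]]; exists x => //; exists y => //; split=> //.
have Xx' : Xsub A t x by apply: Xsub_le Xx; lia.
have nX := Xsub_normal t.
by rewrite -(mulKg x y) xy; apply: (normal_inM nX) => //; exact: (normal_inV nX).
Qed.

(** * Generators and the filtration from X^t down to X^{t+1} *)

Section Basis.
Variable B : basis A l.

Lemma gens_X k t g : gens B k t g -> Xsub A t g.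
Proof. by move=> /gens_span[Ag g1]; split=> // s ?; apply: g1; lia. Qed.

Lemma gens_Y k t g : gens B k t g -> Ysub A (t + (k : nat)%:Z) g.
Proof. by move=> /gens_span[Ag g1]; split=> // s ?; apply: g1; lia. Qed.

(** The quotient of two generators lies in X^t, so by Dedekind's law congruence modulo the larger
    group X^{t+1} Y^{t+k-1} already puts them in the same coset of Lambda^{[t,t+k]}. *)
Lemma gens_inj k t g g' : gens B k t g -> gens B k t g' ->
  XY (t + 1) (t + (k : nat)%:Z - 1) (g * g'^-1)%g -> g = g'.
Proof.
move=> Bg Bg' /Xsub_XY_XXY Ngg'; have nX := Xsub_normal t.
apply: (transversal_inj system_normal (XXY_normal _ _) _
  (gens_transversal B k t)) => //.
  exact: normal_inS (XXY_normal _ _).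
apply: Ngg'; apply: (normal_inM nX); first exact: gens_X Bg.
exact/(normal_inV nX)/gens_X/Bg'.
Qed.

Lemma gens_ex (k : 'I_l.+1) t a : XXY A t (t + (k : nat)%:Z) a ->
  exists2 g, gens B k t g & XXY A t (t + (k : nat)%:Z - 1) (a * g^-1)%g.
Proof.
move=> XYa.
apply: (transversal_ex (XXY_normal _ _) _ (gens_transversal B k t)) => //.
exact: normal_inS (XXY_normal _ _).
Qed.

(** With [XXY_bottom], this shows that the groups [XXY A t (t + k)] descend from X^t at k = l to
    X^{t+1} at k = -1; the successive quotients are the Lambda^{[t,t+k]}. *)
Lemma Xsub_top t : Xsub A t `<=` XXY A t (t + l%:Z).
Proof.
move=> a Xa; apply: Xsub_XY_XXY => //.
have -> : t + l%:Z = t + 1 + l%:Z - 1 by lia.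
by apply: controllable_split; case: Xa.
Qed.

Lemma XXY_bottom t : XXY A t (t - 1) `<=` Xsub A (t + 1).
Proof.
move=> _ [x Xx [y [[_ Xy] [_ Yy]] <-]].
suff -> : y = 1%g by rewrite mulg1.
by apply: seqP => i; case: (ltP i t) => it; [rewrite Xy|rewrite Yy//; lia].
Qed.

(** Descent of the filtration: [m] levels remain, the representative of the top one is divided off
    on the right, and the entries of [g] from [m] on are arbitrary. *)
Lemma column_ex t (m : nat) a : (m <= l.+1)%N -> XXY A t (t + m%:Z - 1) a ->
  exists2 g : 'I_l.+1 -> sequence gT, forall k, gens B k t (g k) &
    Xsub A (t + 1)
      (a * (\prod_(k < l.+1) (if (k < m)%N then g k else 1))^-1)%g.
Proof.
elim: m a => [|m IHm] a ml XYa.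
  exists (fun=> 1%g) => [k|]; first exact: gens_one.
  rewrite big1//; rewrite invg1 mulg1; apply: XXY_bottom.
  by move: XYa; rewrite addr0.
have [|g0 Bg0 Ng0] := @gens_ex (Ordinal ml) t a.
  by move: XYa => /=; have -> : t + m.+1%:Z - 1 = t + m%:Z by lia.
have [g Bg Xg] := IHm _ (ltnW ml) Ng0.
exists (fun k => if k == Ordinal ml then g0 else g k) => [k|].
  by case: eqP => [->|].
move: Xg; rewrite -mulgA -invgM; congr (Xsub A _ (_ * _^-1)%g).
rewrite [RHS](prod_cut m); congr (_ * _)%g.
  apply: eq_bigr => k _; case: ltnP => // km.
  by rewrite ltnS (ltnW km) -val_eqE /= ltn_eqF.
rewrite (big_only1 (Ordinal ml)) //= ?ltnn ?ltnSn ?eqxx// => k km _.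
by case: ltnP => // mk; rewrite ltnS leqNgt ltn_neqAle eq_sym km mk.
Qed.

(** * Columns of generators and the map [alpha] *)

Implicit Types r : gen_tensor B.

Definition gen r k t : sequence gT := val (r k t).

Lemma genP r k t : gens B k t (gen r k t).
Proof. exact: set_valP. Qed.

(** Truncation stays in the tensor set because the identity is a generator at every place. *)
Definition mask (P : pred int) r : gen_tensor B := fun k t =>
  if P t then r k t else exist _ 1%g (mem_set (gens_one B k t)).

Lemma gen_mask P r k t : gen (mask P r) k t = if P t then gen r k t else 1%g.
Proof. by rewrite /gen /mask; case: ifP. Qed.

Definition column r t : sequence gT := (\prod_(k < l.+1) gen r k t)%g.

Lemma column_mask P r t :
  column (mask P r) t = if P t then column r t else 1%g.
Proof.
rewrite /column; under eq_bigr do rewrite gen_mask.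
by case: ifP => // _; rewrite big1.
Qed.

Lemma column_X r t : Xsub A t (column r t).
Proof. by apply: (prod_in (Xsub_normal t)) => k _; apply: gens_X (genP _ _ _). Qed.

Lemma column_Y r t : Ysub A (t + l%:Z) (column r t).
Proof.
apply: (prod_in (Ysub_normal _)) => k _.
by apply: Ysub_le (gens_Y (genP _ _ _)); have := ltn_ord k; lia.
Qed.

(** The generators with k < j, absent from [alpha], end before time t and can be put back to
    complete the columns. *)
Lemma alphaE r t : alpha r t = (\prod_(j < l.+1) column r (t - j%:Z) t)%g.
Proof.
apply: eq_bigr => j _; rewrite /column seq_prodE big_mkcond; apply: eq_bigr => k _.
case: leqP => // kj; have [_ ->//] := gens_Y (genP r k (t - j%:Z)).
by have := ltn_ord k; lia.
Qed.

Lemma eq_alpha r r' t :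
    (forall j, (j <= l)%N -> column r (t - j%:Z) t = column r' (t - j%:Z) t) ->
  alpha r t = alpha r' t.
Proof.
by move=> rr'; rewrite !alphaE; apply: eq_bigr => j _; apply: rr'; rewrite -ltnS.
Qed.

Lemma alpha_cut n r :
  alpha r =
  (alpha (mask (fun t => n < t) r) * alpha (mask (fun t => t <= n) r))%g.
Proof.
apply: seqP => t; rewrite seqE !alphaE.
(* The factors at time t run through start times t, t-1, and so on; the first [m] of them are those
   starting after [n]. *)
pose m := if t - n is Posz m then m else 0%N.
have mP (j : nat) : (n < t - j%:Z) = (j < m)%N.
  by rewrite /m; case E: (t - n) => [p|p]; lia.
rewrite (prod_cut m); congr (_ * _)%g; apply: eq_bigr => j _; rewrite column_mask.
  by rewrite mP; case: ifP.
by rewrite leNgt mP; case: ifP.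
Qed.

(** A finite product in the group itself, hence in [A], whereas [alpha] is only defined
    componentwise. *)
Definition stack n (c : nat) r : sequence gT :=
  (\prod_(j < c) column r (n - j%:Z))%g.

Lemma stack_in n (c : nat) r : A (stack n c r).
Proof.
by apply: (prod_in system_normal) => j _; case: (column_X r (n - (j : nat)%:Z)).
Qed.

Lemma alpha_column r t :
  (forall s, s != t -> column r s = 1%g) -> alpha r = column r t.
Proof.
move=> r1; apply: seqP => i; rewrite alphaE.
have [/andP[ti it]|out] := boolP (t <= i <= t + l%:Z); last first.
  have -> : column r t i = 1%g.
    move: out; rewrite negb_and -!ltNge => /orP[it|it].
      by case: (column_X r t) => _; apply.
    by case: (column_Y r t) => _; apply.
  rewrite big1// => j _; rewrite r1//; apply: contra out => /eqP.
  by have := ltn_ord j; lia.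
have jl : (`|i - t| < l.+1)%N by lia.
rewrite (big_only1 (Ordinal jl))//=.
  by congr (column r _ i); lia.
by move=> j; rewrite -val_eqE/= => jt _; rewrite r1//; lia.
Qed.

Lemma alpha_stack n (c : nat) r :
    (forall t, ~~ (n - c%:Z < t <= n) -> column r t = 1%g) ->
  alpha r = stack n c r.
Proof.
elim: c r => [|c IHc] r r1.
  rewrite /stack big_ord0; apply: seqP => t.
  by rewrite alphaE big1// => j _; rewrite r1//; lia.
rewrite (alpha_cut (n - c%:Z)) /stack big_ord_recr /=; congr (_ * _)%g.
  rewrite IHc => [|t out]; last first.
    by rewrite column_mask; case: ifP => // nt; apply: r1; lia.
  by apply: eq_bigr => j _; rewrite column_mask ifT//; have := ltn_ord j; lia.
rewrite (@alpha_column _ (n - c%:Z)) => [|t /eqP tn].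
  by rewrite column_mask ifT.
by rewrite column_mask; case: ifP => // tn'; apply: r1; lia.
Qed.

Lemma alpha_in r : A (alpha r).
Proof.
apply: A_complete => m n.
have [mn|nm] := leP m n; last first.
  by exists 1%g; [exact: normal_in1 system_normal|lia].
(* On [m, n] only columns starting in [m - l, n] are visible. There are [c] of them, so the
   truncation is a stack in [A], and completeness applies. *)
pose c := (`|n - m|.+1 + l)%N.
pose r' := mask (fun t => n - c%:Z < t <= n) r.
exists (alpha r') => [|t mtn].
  rewrite (@alpha_stack n c); first exact: stack_in.
  by move=> t /negbTE out; rewrite column_mask out.
by apply: eq_alpha => j jl; rewrite column_mask ifT//; lia.
Qed.

Lemma alpha_X r n :
  (forall t, t <= n -> column r t = 1%g) -> Xsub A (n + 1) (alpha r).
Proof.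
move=> r1; split=> [|t tn]; first exact: alpha_in.
by rewrite alphaE big1// => j _; rewrite r1//; lia.
Qed.

Lemma alpha_Y r n :
  (forall t, n < t -> column r t = 1%g) -> Ysub A (n + l%:Z) (alpha r).
Proof.
move=> r1; split=> [|t tn]; first exact: alpha_in.
by rewrite alphaE big1// => j _; rewrite r1//; have := ltn_ord j; lia.
Qed.

(** Two cuts write [alpha r] as x * stack * y, where x collects the columns starting after n and y
    those starting at n - c or earlier; normality moves y past the stack. *)
Lemma alpha_cong_stack n (c : nat) r :
  XY (n + 1) (n - c%:Z + l%:Z) (alpha r * (stack n c r)^-1)%g.
Proof.
set e := _ + l%:Z; have nN := XY_normal (n + 1) e.
pose r1 := mask (fun t => t <= n) r.
have -> : stack n c r = alpha (mask (fun t => n - c%:Z < t) r1).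
  rewrite (@alpha_stack n c) => [|t out].
    by apply: eq_bigr => j _; rewrite !column_mask !ifT//; have := ltn_ord j; lia.
  by rewrite !column_mask; move: out; case: ltP => // _; case: leP.
rewrite (alpha_cut n r) -/r1 (alpha_cut (n - c%:Z) r1).
set x := alpha (mask _ r); set y := alpha (mask (fun t => t <= n - c%:Z) r1).
set a := alpha _; rewrite -mulgA.
apply: (normal_inM nN).
  apply: Xsub_XY; apply: alpha_X => t tn.
  by rewrite column_mask ltNge tn.
apply: (normal_inJ nN); first exact: alpha_in.
apply: Ysub_XY; apply: alpha_Y => t nt.
by rewrite column_mask leNgt nt.
Qed.

(** * Triangles of generators as classes modulo N_t *)

Definition tri r t : sequence gT :=
  (\prod_(j < l.+1) \prod_(k < l.+1 | (j <= k)%N) gen r k (t - j%:Z)%R)%g.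

Lemma alpha_cong_tri r t : XY (t + 1) (t - 1) (alpha r * (tri r t)^-1)%g.
Proof.
have nN := XY_normal (t + 1) (t - 1).
(* Depth l + 1 is chosen because columns starting before t - l end before t. In the remaining
   columns, generators with k < j end before t too and drop out. *)
apply: (cong_trans nN (b := stack t l.+1 r)).
  have := alpha_cong_stack t l.+1 r.
  by rewrite (_ : t - l.+1%:Z + l%:Z = t - 1)//; lia.
have gA k s : A (gen r k s) by case: (gens_X (genP r k s)).
rewrite /stack /tri; apply: (cong_prod nN) => [j|j _].
  by apply: (prod_in system_normal) => k _.
rewrite [X in (_ * X^-1)%g]big_mkcond.
rewrite /column; apply: (cong_prod nN) => // k _.
case: leqP => kj; first exact: (cong_refl nN).
rewrite invg1 mulg1; apply: Ysub_XY; apply: Ysub_le (gens_Y (genP _ _ _)).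
by lia.
Qed.

Lemma column_inj (g g' : 'I_l.+1 -> sequence gT) t (j : nat) :
    (forall k, gens B k t (g k)) -> (forall k, gens B k t (g' k)) ->
    XY (t + 1) (t + j%:Z - 1)
      ((\prod_(k < l.+1 | (j <= k)%N) g k) *
       (\prod_(k < l.+1 | (j <= k)%N) g' k)^-1)%g ->
  forall k : 'I_l.+1, (j <= k)%N -> g k = g' k.
Proof.
move=> Bg Bg'; rewrite big_mkcond [X in (_ * X^-1)%g]big_mkcond => Ngg' k jk.
(* Modulo [M i] the generators of levels j to i - 1 vanish. Below level j both factors are 1, and
   the maximum only keeps the given group inside [M i]. *)
pose M (i : 'I_l.+1) := XY (t + 1) (t + (maxn j i)%:Z - 1).
suff : (if (j <= k)%N then g k else 1%g) = (if (j <= k)%N then g' k else 1%g).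
  by rewrite jk.
move: k {jk}; apply: (prod_cong_inj (M := M)) Ngg' => [||i|i i' ii'|i].
- exact: system_normal.
- by move=> i; exact: XY_normal.
- by apply: XY_le; lia.
- have nM := XY_normal (t + 1) (t + (maxn j i)%:Z - 1).
  split; case: ifP => _; try exact: (normal_in1 nM); apply: Ysub_XY.
    by apply: Ysub_le (gens_Y (Bg _)); lia.
  by apply: Ysub_le (gens_Y (Bg' _)); lia.
- by case: leqP => // ji; rewrite /M (maxn_idPr ji); exact: gens_inj.
Qed.

Definition agree r r' t := forall j k : 'I_l.+1,
  (j <= k)%N -> gen r k (t - j%:Z) = gen r' k (t - j%:Z).

Lemma tri_inj r r' t :
  XY (t + 1) (t - 1) (tri r t * (tri r' t)^-1)%g -> agree r r' t.
Proof.
(* The columns to the left of column j start at t - j + 1 or later, hence lie in [M j]; as t - 1 =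
   (t - j) + j - 1, [M j] is also the modulus needed by [column_inj]. *)
pose M (j : 'I_l.+1) := XY (t - (j : nat)%:Z + 1) (t - 1).
have nM j : normal_in A (M j) by exact: XY_normal.
have inj (j : 'I_l.+1) :
    M j ((\prod_(k < l.+1 | (j <= k)%N) gen r k (t - (j : nat)%:Z)) *
         (\prod_(k < l.+1 | (j <= k)%N) gen r' k (t - (j : nat)%:Z))^-1)%g ->
    forall k : 'I_l.+1, (j <= k)%N ->
      gen r k (t - (j : nat)%:Z) = gen r' k (t - (j : nat)%:Z).
  move=> Mj; apply: column_inj; try by move=> k; exact: genP.
  by move: Mj; rewrite /M; congr (XY _ _ _); lia.
have X1 r0 (i j : 'I_l.+1) : (j < i)%N ->
    M i (\prod_(k < l.+1 | (j <= k)%N) gen r0 k (t - (j : nat)%:Z))%g.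
  move=> ji; apply: (prod_in (nM i)) => k _; apply: Xsub_XY.
  by apply: Xsub_le (gens_X (genP _ _ _)); lia.
(* Peeling yields equality of whole column products; [inj] then separates the generators in each. *)
move=> Ntri j; apply: (inj j).
rewrite [X in (X * _)%g](_ : _ =
  \prod_(k < l.+1 | (j <= k)%N) gen r' k (t - (j : nat)%:Z))%g.
  exact: (cong_refl (nM j)).
move: j; apply: (prod_cong_inj (M := M)) Ntri => [||i|i i' ii'|i Mi].
- exact: system_normal.
- exact: nM.
- by apply: XY_le; lia.
- by split; apply: X1.
- by apply: eq_bigr => k ik; apply: inj.
Qed.

Lemma alpha_congP r r' t :
  XY (t + 1) (t - 1) (alpha r * (alpha r')^-1)%g <-> agree r r' t.
Proof.
have nN := XY_normal (t + 1) (t - 1).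
have rt := alpha_cong_tri r t; have rt' := alpha_cong_tri r' t.
split=> [Nrr'|rr'].
  apply: tri_inj; apply: (cong_trans nN (cong_sym nN rt)).
  exact: (cong_trans nN Nrr').
apply: (cong_trans nN rt); rewrite (_ : tri r t = tri r' t).
  exact: (cong_sym nN).
by apply: eq_bigr => j _; apply: eq_bigr => k jk; apply: rr'.
Qed.

Lemma alpha_inj r r' : alpha r = alpha r' -> r = r'.
Proof.
move=> rr'; apply: functional_extensionality_dep => k.
apply: functional_extensionality_dep => t; apply: val_inj.
(* Column 0 of the triangle at t contains every generator starting at t. *)
have /alpha_congP/(_ ord0 k isT) : XY (t + 1) (t - 1) (alpha r * (alpha r')^-1)%g.
  by rewrite rr'; exact: (cong_refl (XY_normal _ _)).
by rewrite /= subr0.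
Qed.

(** * Surjectivity of [alpha] onto A *)

Lemma stack_ex s (c : nat) x : Xsub A s x -> exists r,
  Xsub A (s + c%:Z) (x * (stack (s + c%:Z - 1) c r)^-1)%g.
Proof.
move=> Xx; elim: c => [|c [r IHc]].
  exists (fun k t => exist _ 1%g (mem_set (gens_one B k t))).
  by rewrite /stack big_ord0 invg1 mulg1 addr0.
have XYl : XXY A (s + c%:Z) (s + c%:Z + l.+1%:Z - 1)
    (x * (stack (s + c%:Z - 1) c r)^-1)%g.
  by move: (Xsub_top IHc); congr (XXY A _ _ _); lia.
have [g Bg Xg] := column_ex (leqnn _) XYl.
(* The new column becomes the leftmost factor; the old stack uses only earlier start times and is
   unchanged. *)
pose h k t := if t == s + c%:Z then g k else gen r k t.
have Bh k t : gens B k t (h k t).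
  by rewrite /h; case: eqP => [->|_] //; exact: genP.
exists (fun k t => exist _ (h k t) (mem_set (Bh k t))).
move: Xg; rewrite -mulgA -invgM; congr (Xsub A _ (_ * _^-1)%g); first lia.
rewrite /stack [RHS]big_ord_recl; congr (_ * _)%g; apply: eq_bigr => i _.
  by rewrite ltn_ord /gen /= /h ifT//; lia.
apply: eq_bigr => k _; rewrite {2}/gen /= /h ifF /bump /=; last lia.
by congr (gen r k _); lia.
Qed.

(** The modulus lies in N_t whenever s + l <= t < s + c, so one [r] serves for that whole window. *)
Lemma alpha_approx s (c : nat) a : A a -> exists r,
  XY (s + c%:Z) (s + l%:Z - 1) (a * (alpha r)^-1)%g.
Proof.
move=> Aa; have nN := XY_normal (s + c%:Z) (s + l%:Z - 1).
have [x Xx [y Yy <-]] := controllable_split s Aa.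
have [r Xr] := stack_ex c Xx; exists r.
apply: (cong_trans nN (b := x)).
  apply: (normal_inJ nN); first by case: Xx.
  exact: Ysub_XY.
apply: (cong_trans nN (Xsub_XY _ Xr)); apply: (cong_sym nN).
by move: (alpha_cong_stack (s + c%:Z - 1) c r); congr (XY _ _ _); lia.
Qed.

Lemma alpha_surj a : A a -> exists r, alpha r = a.
Proof.
move=> Aa.
(* These parameters make [f t] valid modulo N_i for t <= i <= t + l, the times i whose triangle
   meets column t. *)
have /choice[f fP] t := alpha_approx (t - l%:Z) (l + l.+1) Aa.
have af t (j : nat) : (j <= l)%N ->
    XY (t + 1) (t - 1) (alpha (f (t - j%:Z)) * a^-1)%g.
  move=> jl; apply: (cong_sym (XY_normal _ _)).
  by apply: XY_le (fP (t - j%:Z)); lia.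
(* Diagonal gluing: column t comes from [f t]. On the triangle at t, [f (t - j)] and [f t] agree
   because both represent [a] modulo N_t. *)
exists (fun k t => f t k t); apply: seqP => t.
have aft : XY (t + 1) (t - 1) (alpha (f t) * a^-1)%g.
  by have := af t 0%N (leq0n _); rewrite subr0.
rewrite -(XY_at aft); apply: XY_at.
apply/alpha_congP => j k jk.
rewrite [LHS](_ : _ = gen (f (t - (j : nat)%:Z)) k (t - (j : nat)%:Z))//.
suff /alpha_congP : XY (t + 1) (t - 1)
    (alpha (f (t - (j : nat)%:Z)) * (alpha (f t))^-1)%g by apply.
apply: (cong_trans (XY_normal _ _) (af t j _)); first by rewrite -ltnS.
exact: (cong_sym (XY_normal _ _)).
Qed.

(** * Transfer to labels and the global operation *)

Section Labels.
Variable L : labelling B.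
Implicit Types u v w : label_tensor (lab L).

Lemma betaK r : beta_inv (beta L r) = r.
Proof.
apply: functional_extensionality_dep => k.
by apply: functional_extensionality_dep => t; exact: labelK.
Qed.

Lemma beta_invK u : beta L (beta_inv u) = u.
Proof.
apply: functional_extensionality_dep => k.
by apply: functional_extensionality_dep => t; exact: unlabelK.
Qed.

Lemma f_uE u : f_u u = alpha (beta_inv u).
Proof. by []. Qed.

Lemma f_u_inj u v : f_u u = f_u v -> u = v.
Proof. by rewrite !f_uE => /alpha_inj uv; rewrite -(beta_invK u) uv beta_invK. Qed.

Lemma f_u_surj a : A a -> exists u, f_u u = a.
Proof. by move=> /alpha_surj[r ra]; exists (beta L r); rewrite f_uE betaK. Qed.

Lemma f_u_in u : A (f_u u).
Proof. by rewrite f_uE; exact: alpha_in. Qed.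

Lemma f_u_lab_op u v : f_u (lab_op u v) = (f_u u * f_u v)%g.
Proof.
rewrite f_uE betaK; rewrite /gen_op; set P := [set r | _].
suff : P (xget (beta_inv u) P) by [].
(* The product lies in [A], so surjectivity of [alpha] rules out the default value. *)
apply: xgetPex; rewrite /P.
by apply: alpha_surj; apply: (normal_inM system_normal); exact: alpha_in.
Qed.

Lemma nablaP u v t :
  nabla ord0 t u = nabla ord0 t v <-> agree (beta_inv u) (beta_inv v) t.
Proof.
split=> [uv j k jk|uv].
  have Tjk : tri_index ord0 t (k, t - (j : nat)%:Z).
    by exists j; split; rewrite ?subn0 -1?ltnS.
  pose p : tri_index ord0 t := exist _ (k, t - (j : nat)%:Z) (mem_set Tjk).
  have := congr1 (fun w : triangle (lab L) ord0 t => w p) uv.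
  by rewrite /gen /beta_inv /nabla /= => ->.
apply: functional_extensionality_dep => -[[k s] Tks].
have [j [jl jk /= st]] := set_mem Tks; rewrite /nabla /=.
rewrite subn0 -ltnS in jl; rewrite {}st {Tks}.
apply: (can_inj (@unlabelK _ _ _ _ L k (t - j%:Z))); apply: val_inj.
exact: uv (Ordinal jl) k jk.
Qed.

Lemma nabla_f_u u v t :
  nabla ord0 t u = nabla ord0 t v <->
  XY (t + 1) (t - 1) (f_u u * (f_u v)^-1)%g.
Proof. by rewrite nablaP -alpha_congP. Qed.

(** Independence of representatives: equal triangles mean images congruent modulo the normal
    subgroup N_t, and such congruences multiply. *)
Lemma triangle_op_nabla u v t :
  triangle_op (nabla ord0 t u) (nabla ord0 t v) = nabla ord0 t (lab_op u v).
Proof.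
rewrite /triangle_op; set P := [set _ | _].
have : P (xget (nabla ord0 t u) P).
  by apply: xgetPex; exists (nabla ord0 t (lab_op u v)), u, v.
move=> [u' [v' [/nabla_f_u uu' /nabla_f_u vv' ->]]].
apply/nabla_f_u; rewrite !f_u_lab_op.
by apply: (cong_mul (XY_normal _ _)) => //; exact: f_u_in.
Qed.

(** [lab_op u v] meets every triangle condition, and any solution is determined by the columns 0 of
    its triangles. *)
Lemma global_op_lab_op u v : global_op (elementary_system_of L) u v = lab_op u v.
Proof.
rewrite /global_op; set P := [set _ | _].
have : P (xget u P).
  by apply: xgetPex; exists (lab_op u v) => t; rewrite /= triangle_op_nabla.
move: (xget u P) => w Pw; apply: functional_extensionality_dep => k.
apply: functional_extensionality_dep => t.
have := Pw t; rewrite /= triangle_op_nabla => /nablaP/(_ ord0 k isT).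
rewrite /= subr0 => /val_inj e.
exact: (can_inj (@unlabelK _ _ _ _ L k t)) e.
Qed.

End Labels.
End Basis.
End System.

Theorem theorem76 (gT : int -> finGroupType) (A : set (sequence gT)) (l : nat)
    (l_gt0 : (0 < l)%N) (A_sys : group_system A) (A_ctrl : controllable A l)
    (A_complete : complete A) (B : basis A l) (L : labelling B) :
  let star := global_op (elementary_system_of L) in
  [/\ group_law star,
      forall u v : label_tensor (lab L),
        f_u (star u v) = (f_u u * f_u v)%g &
      range (@f_u gT A l B L) = A].
Proof.
move=> star; have nA := system_normal A_sys.
have fM u v : f_u (star u v) = (f_u u * f_u v)%g.
  by rewrite /star global_op_lab_op// f_u_lab_op.
have surj := f_u_surj A_sys A_ctrl A_complete L.
have inj := f_u_inj A_sys A_complete (L := L).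
split=> //; last first.
  apply/seteqP; split=> [_ [u _ <-]|a /surj[u <-]]; last by exists u.
  exact: f_u_in.
(* The unit and the inverses are preimages under [f_u]; since [f_u] is injective and multiplicative,
   each law reduces to that of sequences. *)
have [e fe] := surj _ (normal_in1 nA).
have /choice[inv fV] (u : label_tensor (lab L)) :
    exists v : label_tensor (lab L), f_u v = ((f_u u)^-1)%g.
  by apply: surj; apply: (normal_inV nA); exact: f_u_in.
exists e, inv; split=> [u v w|u|u|u|u]; apply: inj; rewrite !fM ?fe ?fV.
- exact: mulgA.
- exact: mul1g.
- exact: mulg1.
- exact: mulVg.
- exact: mulgV.
Qed.
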